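(* Consider the noise-free linear system $x_{t+1}=A_tx_t+B_tu_t$, $y_t=C_tx_t$ ($t\in\mathbb{N}$), and the estimator defined, from an arbitrary initial estimate $\hat{x}_0\in\mathbb{R}^n$, for $t\ge 1$ by $$\hat{x}_{t|t-1}=A_{t-1}\hat{x}_{t-1}+B_{t-1}u_{t-1},$$ $$\hat{x}_t=\operatorname*{arg\,min}_{z\in\mathbb{R}^n}\Big[\tfrac12\big\|W_t^{-1}(z-\hat{x}_{t|t-1})\big\|_2^2+\psi\big(V_t^{-1}(y_t-C_tz)\big)\Big].$$ Assume the following. 1. The function $\psi:\mathbb{R}^{n_y}\to\mathbb{R}_+$ is convex, continuous and positive definite. 2. The matrices $W_t\in\mathbb{R}^{n\times n}$, $V_t\in\mathbb{R}^{n_y\times n_y}$ are symmetric positive definite and there are positive real numbers $a_w,b_w,a_v,b_v$ such that $a_wI\preceq W_t\preceq b_wI$ and $a_vI\preceq V_t\preceq b_vI$ for all $t$. 3. The sequences $\{A_t\}$, $\{C_t\}$ are bounded and $D_t(e)\le 0$ for all $t\geq 1$ and all $e\in\mathbb{R}^n$, where $$D_t(e)=e^\top\big(A_{t-1}^\top W_t^{-2}A_{t-1}-W_{t-1}^{-2}\big)e-2\psi\big(V_{t-1}^{-1}C_{t-1}e\big).$$ 4. There exist a fixed $T\in\mathbb{N}$ and a nondecreasing and positive definite function $\alpha_0:\mathbb{R}_+\to\mathbb{R}_+$ such that $\Sigma_t(e)\ge\alpha_0(\|e\|)$ for all $t\ge T$ and all $e\in\mathbb{R}^n$, where $\Sigma_t(e)$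 is the quantity defined in the context. Then the state estimation error $e_t=\hat{x}_t-x_t$ converges to $0$ as $t\to+\infty$.
   Context: Here $x_t\in\mathbb{R}^n$ is the state, $u_t\in\mathbb{R}^{n_u}$ a known input, $y_t\in\mathbb{R}^{n_y}$ the output, and $A_t,B_t,C_t$ are real matrices of compatible dimensions. $\|\cdot\|_2$ is the Euclidean norm, $\|\cdot\|$ is an arbitrary fixed vector norm, and $S_1\preceq S_2$ means that $S_2-S_1$ is positive semidefinite. A function is positive definite if it is nonnegative, vanishes at $0$, and is strictly positive elsewhere on its domain. The subdifferential of $f:\mathbb{R}^n\to\mathbb{R}$ at $x$ is $\partial f(x)=\{g: f(y)-f(x)\ge g^\top(y-x)\ \forall y\in\mathbb{R}^n\}$. Definition of $\Sigma_t$. Let $\tilde g_k(e)=\psi(V_k^{-1}C_ke)$. For $t\ge T$ and $e\in\mathbb{R}^n$, $$\Sigma_t(e)=\sum_{k=t-T}^{t-1}\xi_k^\top W_k^2\,\xi_k,$$ where $e_{t-T}=e$, $\xi_{k}\in\partial\tilde g_{k}(e_{k})$ for $k=t-T,\dots,t-1$, and $e_k=A_{k-1}e_{k-1}-W_k^2\xi_k$ for $k=t-T+1,\dots,t-1$. (For $k\ge t-T+1$, $\xi_k$ and $e_k$ are uniquely determined by $e_{k-1}$.) The inequality $\Sigma_t(e)\ge\alpha_0(\|e\|)$ is understood for every admissible choice of the initial subgradient $\xi_{t-T}\in\partial\tilde g_{t-T}(e)$. *)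

(* Defs.v *)
From HB Require Import structures.
From mathcomp Require Import all_boot all_order all_algebra.
From mathcomp Require Import all_classical all_reals all_analysis.

Set Implicit Arguments.
Unset Strict Implicit.
Unset Printing Implicit Defensive.

Import Order.TTheory GRing.Theory Num.Theory.
Import numFieldNormedType.Exports.

Local Open Scope classical_set_scope.
Local Open Scope ring_scope.

Definition euclid_norm (R : realType) n (v : 'cV[R]_n) : R :=
  Num.sqrt (\sum_i v i ord0 ^+ 2).

Definition is_vector_norm (R : realType) n (N : 'cV[R]_n -> R) : Prop :=
  [/\ forall v w, N (v + w) <= N v + N w,
      forall (a : R) v, N (a *: v) = `|a| * N v
    & forall v, N v = 0 -> v = 0].

Definition dotp (R : realType) n (v w : 'cV[R]_n) : R := (v^T *m w) ord0 ord0.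

Definition qform (R : realType) n (S : 'M[R]_n) (v : 'cV[R]_n) : R :=
  (v^T *m S *m v) ord0 ord0.

Definition psd_mx (R : realType) n (S : 'M[R]_n) : Prop :=
  S^T = S /\ forall v, 0 <= qform S v.

Definition pd_mx (R : realType) n (S : 'M[R]_n) : Prop :=
  S^T = S /\ forall v, v != 0 -> 0 < qform S v.

Definition loewner_le (R : realType) n (S1 S2 : 'M[R]_n) : Prop :=
  psd_mx (S2 - S1).

Definition positive_definite_on (R : realType) (E : zmodType)
    (D : set E) (f : E -> R) : Prop :=
  [/\ forall v, D v -> 0 <= f v,
      f 0 = 0
    & forall v, D v -> v != 0 -> 0 < f v].

Definition subdifferential (R : realType) n (f : 'cV[R]_n -> R)
    (v : 'cV[R]_n) : set 'cV[R]_n :=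
  [set g | forall w, f w - f v >= dotp g (w - v)].

Definition argmin (R : realType) (E : Type) (J : E -> R) : set E :=
  [set z | forall z', J z <= J z'].

Definition linear_system (R : realType) n nu ny
    (A : nat -> 'M[R]_n) (B : nat -> 'M[R]_(n, nu)) (C : nat -> 'M[R]_(ny, n))
    (u : nat -> 'cV[R]_nu) (x : nat -> 'cV[R]_n) (y : nat -> 'cV[R]_ny) : Prop :=
  forall t, x t.+1 = A t *m x t + B t *m u t /\ y t = C t *m x t.

Definition estimator_cost (R : realType) n ny (C : nat -> 'M[R]_(ny, n))
    (W : nat -> 'M[R]_n) (V : nat -> 'M[R]_ny) (psi : 'cV[R]_ny -> R)
    (y : nat -> 'cV[R]_ny) (t : nat) (xpred z : 'cV[R]_n) : R :=
  2^-1 * euclid_norm (invmx (W t) *m (z - xpred)) ^+ 2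
  + psi (invmx (V t) *m (y t - C t *m z)).

(* The minimizer is unique when W t is invertible and psi is convex (the cost
   is then strictly convex), so membership in the argmin set is the equality
   "xhat t = argmin". The initial estimate [xhat 0] is unconstrained. *)
Definition is_estimator (R : realType) n nu ny
    (A : nat -> 'M[R]_n) (B : nat -> 'M[R]_(n, nu)) (C : nat -> 'M[R]_(ny, n))
    (W : nat -> 'M[R]_n) (V : nat -> 'M[R]_ny) (psi : 'cV[R]_ny -> R)
    (u : nat -> 'cV[R]_nu) (y : nat -> 'cV[R]_ny)
    (xhat : nat -> 'cV[R]_n) : Prop :=
  forall t, (1 <= t)%N ->
    let xpred := A t.-1 *m xhat t.-1 + B t.-1 *m u t.-1 in
    argmin (estimator_cost C W V psi y t xpred) (xhat t).

Definition D_fun (R : realType) n ny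
    (A : nat -> 'M[R]_n) (C : nat -> 'M[R]_(ny, n))
    (W : nat -> 'M[R]_n) (V : nat -> 'M[R]_ny) (psi : 'cV[R]_ny -> R)
    (t : nat) (e : 'cV[R]_n) : R :=
  qform ((A t.-1)^T *m invmx (W t) ^+ 2 *m A t.-1 - invmx (W t.-1) ^+ 2) e
  - 2 * psi (invmx (V t.-1) *m C t.-1 *m e).

Definition g_tilde (R : realType) n ny (C : nat -> 'M[R]_(ny, n))
    (V : nat -> 'M[R]_ny) (psi : 'cV[R]_ny -> R)
    (k : nat) (e : 'cV[R]_n) : R :=
  psi (invmx (V k) *m C k *m e).

(* Only the values of [eps] and [xi] at k = t - T, ..., t - 1 matter. The
   recursion for [eps] is implicit, since xi k is a subgradient at eps k. *)
Definition Sigma_admissible (R : realType) n ny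
    (A : nat -> 'M[R]_n) (C : nat -> 'M[R]_(ny, n))
    (W : nat -> 'M[R]_n) (V : nat -> 'M[R]_ny) (psi : 'cV[R]_ny -> R)
    (T t : nat) (e : 'cV[R]_n) (eps xi : nat -> 'cV[R]_n) : Prop :=
  [/\ eps (t - T)%N = e,
      forall k, (t - T <= k < t)%N ->
        subdifferential (g_tilde C V psi k) (eps k) (xi k)
    & forall k, (t - T < k < t)%N ->
        eps k = A k.-1 *m eps k.-1 - W k ^+ 2 *m xi k].

(* Sigma_t(e) depends on the choice of the initial subgradient xi (t - T), so
   it is the set of the values obtained for all the admissible choices. *)
Definition Sigma (R : realType) n ny
    (A : nat -> 'M[R]_n) (C : nat -> 'M[R]_(ny, n))
    (W : nat -> 'M[R]_n) (V : nat -> 'M[R]_ny) (psi : 'cV[R]_ny -> R)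
    (T t : nat) (e : 'cV[R]_n) : set R :=
  [set s | exists eps xi : nat -> 'cV[R]_n,
     Sigma_admissible A C W V psi T t e eps xi /\
     s = \sum_(t - T <= k < t) qform (W k ^+ 2) (xi k)].

(* Main.v *)
Require Import Defs.
From HB Require Import structures.
From mathcomp Require Import all_boot all_order all_algebra.
From mathcomp Require Import all_classical all_reals all_analysis.
From mathcomp Require Import ring lra.

Import Order.TTheory GRing.Theory Num.Theory.
Import numFieldNormedType.Exports.

Local Open Scope classical_set_scope.
Local Open Scope ring_scope.

(** The proof is a Lyapunov argument. Work with the error [e t = x t - xhat t],
    the opposite of the one in the conclusion: since [y t - C t *m z] equals
    [C t *m (x t - z)], this sign makes the estimator evaluate [psi] exactly as
    [g_tilde] does, although [psi] need not be even. Write [g t] for the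
    function [g_tilde C V psi t] and [p t] for the predicted error
    [A t.-1 *m e t.-1].

    By definition [e t] minimizes [1/2 |W_t^-1 (z - p t)|^2 + g t z], so the
    optimality condition ([prox_subgradient]) says that
    [xi t = W_t^-2 (p t - e t)] is a subgradient of [g t] at [e t]. Thus
    [e t = p t - W_t^2 xi t] is the recursion that defines Sigma, and the errors
    themselves form an admissible trajectory.

    Set [L t = |W_t^-1 e t|^2 + 2 g t (e t)]. Expanding [|W_t^-1 p t|^2] and
    using the subgradient inequality at the origin gives
    [L t + |W_t xi t|^2 <= |W_t^-1 p t|^2] ([prox_descent]), while the
    hypothesis on [D_t] is precisely [|W_t^-1 p t|^2 <= L (t - 1)]. Hence [L] is
    nonincreasing and nonnegative, and summing over a window of length [T]
    bounds Sigma by a difference of two values of [L] at distance [T], which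
    tends to 0 ([nonincreasing_shift_cvg0]). By the observability hypothesis
    [alpha0 (nrm (e t))] tends to 0, and therefore so does [e t]
    ([cvg0_of_comparison]). *)

(** * Inner products and quadratic forms *)

Section InnerProduct.
Context {R : realType} {n : nat}.
Implicit Types v w : 'cV[R]_n.

Lemma dotpE v w : dotp v w = \sum_i v i ord0 * w i ord0.
Proof. by rewrite /dotp mxE; apply: eq_bigr => i _; rewrite mxE. Qed.

Lemma dotpC v w : dotp v w = dotp w v.
Proof. by rewrite !dotpE; apply: eq_bigr => i _; rewrite mulrC. Qed.

Lemma dotpDl v1 v2 w : dotp (v1 + v2) w = dotp v1 w + dotp v2 w.
Proof. by rewrite /dotp linearD mulmxDl mxE. Qed.

Lemma dotpZl a v w : dotp (a *: v) w = a * dotp v w.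
Proof. by rewrite /dotp linearZ /= -scalemxAl mxE. Qed.

Lemma dotpDr v w1 w2 : dotp v (w1 + w2) = dotp v w1 + dotp v w2.
Proof. by rewrite !(dotpC v) dotpDl. Qed.

Lemma dotpZr a v w : dotp v (a *: w) = a * dotp v w.
Proof. by rewrite !(dotpC v) dotpZl. Qed.

Lemma dotpNl v w : dotp (- v) w = - dotp v w.
Proof. by rewrite -scaleN1r dotpZl mulN1r. Qed.

Lemma dotpNr v w : dotp v (- w) = - dotp v w.
Proof. by rewrite !(dotpC v) dotpNl. Qed.

Lemma dotp_ge0 v : 0 <= dotp v v.
Proof. by rewrite dotpE sumr_ge0// => i _; rewrite -expr2 sqr_ge0. Qed.

Lemma sqr_euclid_norm v : euclid_norm v ^+ 2 = dotp v v.
Proof.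
rewrite /euclid_norm sqr_sqrtr ?sumr_ge0// => [|i _]; last exact: sqr_ge0.
by rewrite dotpE.
Qed.

Lemma dotp_trmx (S : 'M[R]_n) v w : dotp (S *m v) w = dotp v (S^T *m w).
Proof. by rewrite /dotp trmx_mul mulmxA. Qed.

Lemma qform_sqr (S : 'M[R]_n) v : S^T = S ->
  qform (S ^+ 2) v = dotp (S *m v) (S *m v).
Proof.
by move=> Ssym; rewrite dotp_trmx Ssym /qform /dotp expr2 -!mulmxA.
Qed.

Lemma qformB (S1 S2 : 'M[R]_n) v : qform (S1 - S2) v = qform S1 v - qform S2 v.
Proof. by rewrite /qform mulmxBr mulmxBl !mxE. Qed.

Lemma qform_congr (S A : 'M[R]_n) v : qform (A^T *m S *m A) v = qform S (A *m v).
Proof. by rewrite /qform trmx_mul !mulmxA. Qed.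

(** A nonzero kernel vector would annihilate the quadratic form. *)
Lemma pd_mx_unit (S : 'M[R]_n) : pd_mx S -> S \in unitmx.
Proof.
move=> [_ Spos]; rewrite unitmxE unitfE; apply/negP => /det0P[v v0 vS].
have := Spos v^T; rewrite -(inj_eq trmx_inj) trmxK trmx0 => /(_ v0).
by rewrite /qform trmxK vS mul0mx mxE ltxx.
Qed.

End InnerProduct.

(** * One proximal step *)

(** First-order optimality of a proximal step, without differentiating:
    minimality is tested along the segment from [z] to [w], where convexity
    bounds [g] by its chord. After division by the step length [s] only a
    remainder of order [s] separates the result from the subgradient
    inequality. *)
Lemma prox_subgradient {R : realType} {n : nat} (g : 'cV[R]_n -> R)
    (Q : 'M[R]_n) (p z : 'cV[R]_n) :
  Q^T = Q ->
  (forall w s, 0 <= s <= 1 -> g (z + s *: (w - z)) <= (1 - s) * g z + s * g w) ->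
  (forall w, 2^-1 * dotp (Q *m (z - p)) (Q *m (z - p)) + g z
     <= 2^-1 * dotp (Q *m (w - p)) (Q *m (w - p)) + g w) ->
  subdifferential g z (Q ^+ 2 *m (p - z)).
Proof.
move=> Qsym gconv zmin w /=.
set d := w - z.
have -> : dotp (Q ^+ 2 *m (p - z)) d = - dotp (Q *m (z - p)) (Q *m d).
  by rewrite expr2 -mulmxA dotp_trmx Qsym -(opprB z) mulmxN dotpNl.
set b := dotp _ _.
set c := dotp (Q *m d) (Q *m d).
have key s : 0 < s -> s <= 1 -> 0 <= b + (g w - g z) + s * (2^-1 * c).
  move=> s0 s1.
  have := zmin (z + s *: d); have := gconv w s.
  rewrite (ltW s0) s1 -/d => /(_ isT).
  have -> : z + s *: d - p = (z - p) + s *: d by rewrite addrAC.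
  rewrite (mulmxDr Q _ (s *: d)) -scalemxAr !dotpDl !dotpDr !dotpZl !dotpZr -/b -/c.
  rewrite (dotpC (Q *m d)) -/b => h1 h2.
  rewrite -(pmulr_rge0 _ s0); lra.
have c0 : 0 <= c := dotp_ge0 _.
(* Were the limit [- h] negative, the step [s = h / (c + h)] would contradict
   [key], because then [s * c < h]. *)
rewrite /Order.ge /= leNgt; apply/negP => lt0.
have {}lt0 : b + (g w - g z) < 0 by lra.
set h := - (b + (g w - g z)) in lt0 *.
have h0 : 0 < h by rewrite /h; lra.
have hc : 0 < c + h by lra.
have s0 : 0 < h / (c + h) by rewrite divr_gt0.
have s1 : h / (c + h) <= 1 by rewrite ler_pdivrMr ?mul1r//; lra.
have := key _ s0 s1; rewrite (_ : b + _ = - h); last by rewrite /h; ring.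
apply/negP; rewrite -ltNge.
have : h / (c + h) * c < h.
  by rewrite mulrAC ltr_pdivrMr// ltr_pM2l//; lra.
lra.
Qed.

(** With [a = W^-1 p] and [b = W^-1 z], one has [W xi = a - b] and
    [xi . z = (a - b) . b], so this is the expansion of the square of
    [a = b + (a - b)]. *)
Lemma prox_energy {R : realType} {n : nat} (W : 'M[R]_n) (p z xi : 'cV[R]_n) :
  W^T = W -> W \in unitmx -> xi = invmx W ^+ 2 *m (p - z) ->
  qform (invmx W ^+ 2) z + 2 * dotp xi z + qform (W ^+ 2) xi
  = qform (invmx W ^+ 2) p.
Proof.
move=> Wsym Wu ->; have Qsym : (invmx W)^T = invmx W by rewrite trmx_inv Wsym.
rewrite !qform_sqr// expr2 -!mulmxA mulKVmx//.
rewrite (dotp_trmx (invmx W) (invmx W *m (p - z)) z) Qsym mulmxBr.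
rewrite !dotpDl !dotpDr !dotpNl !dotpNr (dotpC (invmx W *m z) (invmx W *m p)).
ring.
Qed.

(** The cross term [2 xi . z] of [prox_energy] is at least [2 g z]: this is the
    subgradient inequality tested at the origin, where [g] vanishes. *)
Lemma prox_descent {R : realType} {n : nat} (W : 'M[R]_n) (p z : 'cV[R]_n)
    (g : 'cV[R]_n -> R) :
  W^T = W -> W \in unitmx -> g 0 = 0 ->
  let xi := invmx W ^+ 2 *m (p - z) in
  subdifferential g z xi ->
  qform (invmx W ^+ 2) z + 2 * g z + qform (W ^+ 2) xi
  <= qform (invmx W ^+ 2) p.
Proof.
move=> Wsym Wu g0 xi /(_ 0); rewrite g0 /Order.ge /= !sub0r dotpNr lerN2 => h.
rewrite -(prox_energy W p z xi)//; lra.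
Qed.

(** * Convergence of error sequences *)

Lemma entry_le_norm {R : realType} {m n : nat} (M : 'M[R]_(m, n)) i j :
  `|M i j| <= `|M|.
Proof.
rewrite [leRHS]/Num.norm /= mx_normrE.
exact: (le_bigmax _ (fun ij : 'I_m * 'I_n => `|M ij.1 ij.2|) (i, j)).
Qed.

Lemma norm_trmx {R : realType} {m n : nat} (M : 'M[R]_(m, n)) : `|M^T| = `|M|.
Proof.
rewrite /Num.norm /= !mx_normrE (reindex (fun ij : 'I_m * 'I_n => (ij.2, ij.1))) /=.
  by apply: eq_bigr => ij _; rewrite mxE.
by exists (fun ij => (ij.2, ij.1)) => -[].
Qed.

(** Half of the equivalence of norms in finite dimension: [N] is Lipschitz,
    hence attains a minimum on the compact unit sphere, and the minimum is
    positive. *)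
Lemma vector_norm_lower_bound {R : realType} {n : nat} (N : 'cV[R]_n -> R) :
  is_vector_norm N -> exists2 c : R, 0 < c & forall v, c * `|v| <= N v.
Proof.
move=> [ND NZ N_eq0].
have N0 : N 0 = 0 by rewrite -(scale0r 0) NZ normr0 mul0r.
have NN v : N (- v) = N v by rewrite -scaleN1r NZ normrN1 mul1r.
have N_ge0 v : 0 <= N v by have := ND v (- v); rewrite subrr N0 NN; lra.
have NB v w : `|N v - N w| <= N (v - w).
  rewrite ler_norml; have := ND (v - w) w; rewrite subrK => h1.
  have := ND (w - v) v; rewrite subrK -opprB NN => h2; lra.
pose K := \sum_i N (delta_mx i 0) + 1.
have K0 : 0 < K by rewrite ltr_wpDl// sumr_ge0.
have N_le v : N v <= K * `|v|.
  rewrite {1}[v]matrix_sum_delta; under eq_bigr do rewrite big_ord1.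
  apply: (@le_trans _ _ (\sum_i N (v i 0 *: delta_mx i 0))).
    elim/big_ind2 : _ => [|a b c d h1 h2|//]; first by rewrite N0.
    by rewrite (le_trans (ND _ _))// lerD.
  rewrite /K mulrDl mul1r ler_wpDr// mulr_suml.
  by apply: ler_sum => i _; rewrite NZ mulrC ler_wpM2l// entry_le_norm.
pose f (v : 'rV[R]_n) := N v^T.
have f_cont : continuous f.
  move=> v; apply/(cvgrPdist_lt (F := nbhs v)) => e e0.
  near=> w.
  rewrite /f (le_lt_trans (NB _ _))// -linearB (le_lt_trans (N_le _))//.
  rewrite norm_trmx mulrC -ltr_pdivlMr//.
  near: w; move: (e / K) (divr_gt0 e0 K0).
  by apply/cvgrPdist_lt; exact: cvg_id.
pose S := [set v : 'rV[R]_n | `|v| = 1].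
(* The sphere is empty in dimension 0. *)
have [S0|S0] := eqVneq S set0.
  exists 1 => // v; suff -> : v = 0 by rewrite normr0 mulr0 N0.
  apply/eqP/negP => /negP v0.
  suff : S (`|v|^-1 *: v^T) by rewrite S0.
  by rewrite /S /= normrZ norm_trmx normfV normr_id mulVf// normr_eq0.
have S_compact : compact S.
  apply: bounded_closed_compact.
    by exists 1; split => // M M1 v /= ->; exact: ltW.
  apply: (@preimage_closed _ _ (fun v : 'rV[R]_n => `|v|) [set r | r = 1]).
    by move=> v _; exact: norm_continuous.
  exact: closed_eq.
move/set0P : S0 => S0.
have [v0 /set_mem Sv0 v0_min] :=
  compact_EVT_min S0 S_compact (continuous_subspaceT f_cont).
have v0_neq0 : v0 != 0.
  apply/eqP => v00; move: Sv0; rewrite /S /= v00 normr0 => /eqP.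
  by rewrite eq_sym oner_eq0.
exists (f v0) => [|v].
  rewrite lt_neqAle N_ge0 andbT eq_sym; apply: contra v0_neq0 => /eqP /N_eq0 h.
  by rewrite -[v0]trmxK h trmx0.
have [->|v_neq0] := eqVneq v 0; first by rewrite normr0 mulr0 N0.
have nv0 : 0 < `|v| by rewrite normr_gt0.
have : f v0 <= f (`|v|^-1 *: v^T).
  apply: v0_min; apply/mem_set.
  by rewrite /S /= normrZ norm_trmx normfV normr_id mulVf// normr_eq0.
rewrite /f linearZ /= trmxK NZ normfV normr_id.
by rewrite ler_pdivlMl// mulrC.
Unshelve. all: by end_near.
Qed.

Lemma nonincreasing_shift_cvg0 {R : realType} (L : nat -> R) (T : nat) :
  (forall t, 0 <= L t) -> (forall t, L t.+1 <= L t) ->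
  (fun m => L m - L (m + T)%N) @ \oo --> (0 : R).
Proof.
move=> L0 LS.
have L_cvg : cvgn L.
  apply: nonincreasing_is_cvgn; last by exists 0 => _ [t _ <-].
  by apply/nonincreasing_seqP.
rewrite -(subrr (limn L)); apply: cvgB => //.
by rewrite (cvg_shiftn T).
Qed.

(** A nondecreasing positive definite function detects convergence to 0: it
    stays above [alpha (c * eps) > 0] outside the [N]-ball of radius [c * eps],
    where [c] is the constant of [vector_norm_lower_bound]. *)
Lemma cvg0_of_comparison {R : realType} {n : nat} (N : 'cV[R]_n -> R)
    (alpha : R -> R) (s : nat -> R) (e : nat -> 'cV[R]_n) :
  is_vector_norm N ->
  {in `[0, +oo[ &, {homo alpha : r s / r <= s}} ->
  positive_definite_on `[0, +oo[ alpha ->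
  (forall t, alpha (N (e t)) <= s t) -> s @ \oo --> (0 : R) ->
  e @ \oo --> (0 : 'cV[R]_n).
Proof.
move=> N_norm alpha_homo [_ _ alpha_gt0] alpha_le s_cvg.
have [c c0 N_ge] := vector_norm_lower_bound N N_norm.
apply/cvgr0Pnorm_lt => eps eps0.
have ceps0 : 0 < c * eps by rewrite mulr_gt0.
have alpha_ceps : 0 < alpha (c * eps).
  by apply: alpha_gt0; rewrite ?gt_eqF//= in_itv /= andbT ltW.
near=> t.
rewrite -(ltr_pM2l c0) (le_lt_trans (N_ge _))// ltNge; apply/negP => h.
have := alpha_homo (c * eps) (N (e t)).
rewrite !in_itv /= !andbT (ltW ceps0) (le_trans (ltW ceps0) h) => /(_ isT isT h).
apply/negP; rewrite -ltNge (le_lt_trans (alpha_le _))//.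
rewrite (le_lt_trans (ler_norm _))//.
near: t; move: (alpha _) alpha_ceps.
by apply/cvgr0Pnorm_lt.
Unshelve. all: by end_near.
Qed.

(** * Convergence of the estimator *)

Lemma convex_along {R : realType} {n : nat} (psi : 'cV[R]_n -> R) :
  convex_function setT psi -> forall v w s, 0 <= s <= 1 ->
  psi (v + s *: (w - v)) <= (1 - s) * psi v + s * psi w.
Proof.
move=> psi_convex v w s /andP[s0 s1].
have := psi_convex (Itv01 s0 s1) w v; rewrite !inE => /(_ I I).
rewrite convRE /= /unstable.onem [X in _ <= X]addrC.
suff -> : v + s *: (w - v) =
    conv (Itv01 s0 s1) (w : convex_lmodType 'cV[R]_n) v by [].
rewrite -[RHS]/(s *: w + (1 - s) *: v).
by rewrite scalerBr scalerBl scale1r addrC -addrA [- _ + _]addrC.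
Qed.

Theorem theorem2 (R : realType) (n nu ny : nat)
  (A : nat -> 'M[R]_n) (B : nat -> 'M[R]_(n, nu)) (C : nat -> 'M[R]_(ny, n))
  (W : nat -> 'M[R]_n) (V : nat -> 'M[R]_ny) (psi : 'cV[R]_ny -> R)
  (nrm : 'cV[R]_n -> R)
  (u : nat -> 'cV[R]_nu) (x : nat -> 'cV[R]_n) (y : nat -> 'cV[R]_ny)
  (xhat : nat -> 'cV[R]_n)
  (nrm_norm : is_vector_norm nrm)
  (system : linear_system A B C u x y)
  (estimator : is_estimator A B C W V psi u y xhat)
  (psi_convex : convex_function setT psi)
  (psi_continuous : continuous psi)
  (psi_posdef : positive_definite_on setT psi)
  (W_pd : forall t, pd_mx (W t))
  (V_pd : forall t, pd_mx (V t))
  (WV_bounds : exists aw bw av bv : R,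
    [/\ 0 < aw, 0 < bw, 0 < av & 0 < bv] /\
    forall t, [/\ loewner_le aw%:M (W t), loewner_le (W t) bw%:M,
                  loewner_le av%:M (V t) & loewner_le (V t) bv%:M])
  (A_bounded : bounded_fun A)
  (C_bounded : bounded_fun C)
  (D_le0 : forall t e, (1 <= t)%N -> D_fun A C W V psi t e <= 0)
  (Sigma_ge : exists (T : nat) (alpha0 : R -> R),
    [/\ {in `[0, +oo[ &, {homo alpha0 : r s / r <= s}},
        positive_definite_on `[0, +oo[ alpha0
      & forall t e, (T <= t)%N ->
          forall s, Sigma A C W V psi T t e s -> alpha0 (nrm e) <= s]) :
  (fun t => xhat t - x t) @ \oo --> (0 : 'cV[R]_n).
Proof.
have [T [alpha0 [alpha0_homo alpha0_posdef {}Sigma_ge]]] := Sigma_ge.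
have [psi_ge0 psi0 _] := psi_posdef.
have Wsym t : (W t)^T = W t := (W_pd t).1.
have Wu t : W t \in unitmx := pd_mx_unit _ (W_pd t).
have Qsym t : (invmx (W t))^T = invmx (W t) by rewrite trmx_inv Wsym.
pose e t := x t - xhat t.
pose p t := A t.-1 *m e t.-1.
pose xi t := invmx (W t) ^+ 2 *m (p t - e t).
pose g t := g_tilde C V psi t.
have g_convex t v w s : 0 <= s <= 1 ->
    g t (v + s *: (w - v)) <= (1 - s) * g t v + s * g t w.
  move=> s01; rewrite /g /g_tilde mulmxDr -scalemxAr mulmxBr.
  exact: convex_along.
have xi_sub t : (1 <= t)%N -> subdifferential (g t) (e t) (xi t).
  case: t => // t _; apply: prox_subgradient => // [w s|w]; first exact: g_convex.
  have := estimator t.+1 isT (x t.+1 - w).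
  have [xS _] := system t; have [_ yE] := system t.+1.
  have predE z : z - (A t *m xhat t + B t *m u t) = - ((x t.+1 - z) - p t.+1).
    rewrite /p /e /= mulmxBr xS.
    move: (A t *m x t) (A t *m xhat t) (B t *m u t) => a b c.
    by apply/matrixP => i j; rewrite !mxE; ring.
  have outE z : y t.+1 - C t.+1 *m z = C t.+1 *m (x t.+1 - z).
    by rewrite yE mulmxBr.
  rewrite /estimator_cost /= !predE !outE !sqr_euclid_norm !mulmxN.
  by rewrite !dotpNl !dotpNr !opprK !mulmxA subKr.
pose L t := qform (invmx (W t) ^+ 2) (e t) + 2 * g t (e t).
have L_ge0 t : 0 <= L t.
  by rewrite addr_ge0 ?mulr_ge0 ?qform_sqr ?dotp_ge0 ?psi_ge0.
have L_descent t : L t.+1 + qform (W t.+1 ^+ 2) (xi t.+1) <= L t.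
  have g0 : g t.+1 0 = 0 by rewrite /g /g_tilde mulmx0.
  apply: le_trans (prox_descent (W t.+1) (p t.+1) (e t.+1) (g t.+1) _ _ _ _) _ => //.
    exact: xi_sub.
  have := D_le0 t.+1 (e t) isT; rewrite /D_fun qformB qform_congr /=.
  rewrite -/(g_tilde C V psi t (e t)).
  rewrite -/(g t) /L /p /=; lra.
have L_sum m k :
    \sum_(m.+1 <= i < m.+1 + k) qform (W i ^+ 2) (xi i) <= L m - L (m + k)%N.
  elim: k => [|k IHk]; first by rewrite !addn0 big_geq// subrr.
  rewrite addnS big_nat_recr ?leq_addr//= addnS addSn.
  have := L_descent (m + k)%N; lra.
(* The window starts at [m.+1], not [m]: the error at time 0 does not come from
   a proximal step, so [xi 0] need not be a subgradient. *)
have alpha0_e m : alpha0 (nrm (e m.+1)) <= L m - L (m + T)%N.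
  apply: le_trans (L_sum m T); apply: (Sigma_ge (m.+1 + T)%N); first exact: leq_addl.
  exists e, xi; rewrite /Sigma_admissible addnK; split => //.
  split => // k /andP[mk _]; first by apply: xi_sub; exact: leq_trans mk.
  by rewrite /xi !expr2 -!mulmxA !mulKVmx// subKr.
have eS_cvg : (fun m => e m.+1) @ \oo --> (0 : 'cV[R]_n).
  apply: (cvg0_of_comparison nrm alpha0 _ _ nrm_norm alpha0_homo
    alpha0_posdef alpha0_e).
  apply: nonincreasing_shift_cvg0 => // t.
  by apply: le_trans (L_descent t); rewrite lerDl qform_sqr// dotp_ge0.
have e_cvg : e @ \oo --> (0 : 'cV[R]_n) by rewrite -(cvg_shiftS e).
have -> : (fun t => xhat t - x t) = - e.
  by apply/funext => t; rewrite /e /= opprB.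
by rewrite -oppr0; exact: cvgN.
Qed.
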